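(* Let $N\ge3$, let $\Omega$ be a cone in $\mathbb{R}^N$ or an open domain in $\mathbb{R}^N$ with $0\notin\overline\Omega$, and let $s\in(0,2)$, $\alpha>1$, $\beta>1$, $\alpha+\beta=2^*(s)$, $\lambda,\mu>0$. Then $\widetilde{\mathcal{D}}=\mathcal{D}\setminus\{(0,0)\}$ when $$\kappa>-\Big(\frac\lambda\alpha\Big)^{\frac{\alpha}{2^*(s)}}\Big(\frac\mu\beta\Big)^{\frac{\beta}{2^*(s)}}.$$
   Context: $2^*(s):=\frac{2(N-s)}{N-2}$. A cone in $\mathbb{R}^N$ is an open domain $\Omega$ with Lipschitz boundary such that $tx\in\Omega$ for every $t>0$, $x\in\Omega$. $D_0^{1,2}(\Omega)$ is the completion of $C_c^\infty(\Omega)$ in the norm $(\int_\Omega|\nabla u|^2dx)^{1/2}$; $\mathcal{D}:=D_0^{1,2}(\Omega)\times D_0^{1,2}(\Omega)$ and $$\widetilde{\mathcal{D}}:=\Big\{(u,v)\in\mathcal{D}:\int_\Omega\Big(\lambda\frac{|u|^{2^*(s)}}{|x|^s}+\mu\frac{|v|^{2^*(s)}}{|x|^s}+2^*(s)\kappa\frac{|u|^\alpha|v|^\beta}{|x|^s}\Big)dx>0\Big\}.$$ *)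

(* Defs.v *)
From HB Require Import structures.
From mathcomp Require Import all_boot all_order all_algebra.
From mathcomp Require Import all_classical all_reals all_analysis.

Set Implicit Arguments.
Unset Strict Implicit.
Unset Printing Implicit Defensive.

Import Order.TTheory GRing.Theory Num.Theory.
Import numFieldNormedType.Exports.

Local Open Scope classical_set_scope.
Local Open Scope ring_scope.

Definition rV_display : measure_display -> measure_display.
Proof. exact. Qed.

Section measurable_rV.
Context {d} {T : measurableType d}.
Variable n : nat.

Let coors : 'I_n -> 'rV[T]_n -> T := fun i x => x ord0 i.

Let rV_set0 : g_sigma_preimage coors set0.
Proof. exact: sigma_algebra0. Qed.

Let rV_setC A : g_sigma_preimage coors A -> g_sigma_preimage coors (~` A).
Proof. exact: sigma_algebraC. Qed.

Let rV_bigcup (F : _^nat) : (forall i, g_sigma_preimage coors (F i)) ->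
  g_sigma_preimage coors (\bigcup_i (F i)).
Proof. exact: sigma_algebra_bigcup. Qed.

(* The product sigma-algebra, generated by the coordinates; over R this is the
   Borel sigma-algebra of R^n. *)
HB.instance Definition _ := @isMeasurable.Build (rV_display d)
  'rV[T]_n (g_sigma_preimage coors) rV_set0 rV_setC rV_bigcup.

Lemma measurable_coord (i : 'I_n) :
  measurable_fun [set: 'rV[T]_n] (fun x : 'rV[T]_n => x ord0 i).
Proof.
move=> _ Y mY; rewrite setTI; apply: sub_sigma_algebra => /=.
rewrite -bigcup_seq/=; exists i => /=; first by rewrite mem_index_enum.
by exists Y => //; rewrite setTI.
Qed.

Lemma measurable_fun_coord d1 (T1 : measurableType d1) (f : T1 -> 'rV[T]_n) :
  (forall i, measurable_fun [set: T1] (fun x => f x ord0 i)) ->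
  measurable_fun [set: T1] f.
Proof.
move=> mf; suff sf : g_sigma_preimage (fun i => coors i \o f) `<=` measurable.
  move: sf; rewrite g_sigma_preimage_comp => sf _ A mA.
  by apply: sf; exists A.
apply: smallest_sub; first exact: sigma_algebra_measurable.
rewrite -bigcup_seq/= => A [i _ [B mB <-]]; exact: mf.
Qed.

End measurable_rV.

Section lebesgue_rV.
Variable R : realType.

Definition rV_cons n (p : measurableTypeR R * 'rV[R]_n) : 'rV[R]_n.+1 :=
  \row_i (if unlift ord0 i is Some j then p.2 ord0 j else p.1).

Definition rV_uncons n (x : 'rV[R]_n.+1) : measurableTypeR R * 'rV[R]_n :=
  (x ord0 ord0, \row_j x ord0 (lift ord0 j)).

Lemma rV_consK n : cancel (@rV_cons n) (@rV_uncons n).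
Proof.
case=> a x; rewrite /rV_uncons /rV_cons mxE unlift_none; congr pair.
by apply/rowP => j; rewrite !mxE liftK.
Qed.

Lemma measurable_rV_cons n : measurable_fun setT (@rV_cons n).
Proof.
apply: measurable_fun_coord => i; have [j ->|->] := unliftP ord0 i.
  rewrite (_ : (fun _ => _) = (fun x : 'rV[R]_n => x ord0 j) \o snd).
    by apply: measurableT_comp => //; exact: measurable_coord.
  by apply/funext => p /=; rewrite mxE liftK.
rewrite (_ : (fun _ => _) = fst) //.
by apply/funext => p /=; rewrite mxE unlift_none.
Qed.

Lemma measurable_rV_uncons n : measurable_fun setT (@rV_uncons n).
Proof.
apply/measurable_fun_pairP; split; first exact: measurable_coord.
apply: measurable_fun_coord => i.
rewrite (_ : (fun _ => _) = (fun x : 'rV[R]_n.+1 => x ord0 (lift ord0 i))).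
  exact: measurable_coord.
by apply/funext => x /=; rewrite mxE.
Qed.

Section step.
Variable n : nat.
Variable m : {sigma_finite_measure set 'rV[R]_n -> \bar R}.

Definition lebesgue_rV_step : set 'rV[R]_n.+1 -> \bar R :=
  pushforward (lebesgue_measure \x m)%E (@rV_cons n).

Let pushforward_cons : {measure set 'rV[R]_n.+1 -> \bar R} :=
  measure_function_pushforward__canonical__measure_function_Measure
    (lebesgue_measure \x m)%E (@measurable_rV_cons n).

HB.instance Definition _ := isMeasure.Build _ _ _ lebesgue_rV_step
  (measure0 pushforward_cons) (measure_ge0 pushforward_cons)
  (@measure_semi_sigma_additive _ _ _ pushforward_cons).

Let step_sigma_finite : sigma_finite setT lebesgue_rV_step.
Proof.
have [F UF mF] : sigma_finite setT (lebesgue_measure \x m)%E.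
  have /sigma_finiteP[A [TA ndA Aoo]] := sigma_finiteT (@lebesgue_measure R).
  have /sigma_finiteP[B [TB ndB Boo]] := sigma_finiteT m.
  exists (fun k => A k `*` B k).
    rewrite -setXTT TA TB predeqE => -[x y]; split.
      move=> [/= [i _ Aix] [j _ Bjy]]; exists (maxn i j) => //; split.
      - by move: x Aix; exact/subsetPset/ndA/leq_maxl.
      - by move: y Bjy; exact/subsetPset/ndB/leq_maxr.
    by move=> [k _ []/= ? ?]; split; exists k.
  move=> k; have [? ?] := Aoo k; have [? ?] := Boo k.
  split; first exact: measurableX.
  by rewrite product_measure1E// lte_mul_pinfty// ge0_fin_numE.
exists (fun k => @rV_uncons n @^-1` F k).
  by rewrite -preimage_bigcup -UF.
move=> k; have [mFk Fk] := mF k; split.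
  by rewrite -[X in measurable X]setTI; exact: measurable_rV_uncons.
rewrite /lebesgue_rV_step /pushforward -comp_preimage.
rewrite (_ : _ \o _ = id) //.
by apply/funext => p /=; rewrite rV_consK.
Qed.

HB.instance Definition _ :=
  Measure_isSigmaFinite.Build _ _ _ lebesgue_rV_step step_sigma_finite.

End step.

(* R^0 is a point of mass 1, and R^(n+1) is identified with R * R^n. *)
Fixpoint lebesgue_rV n : {sigma_finite_measure set 'rV[R]_n -> \bar R} :=
  match n with
  | 0 => dirac (0 : 'rV[R]_0)
  | k.+1 => lebesgue_rV_step (lebesgue_rV k)
  end.

End lebesgue_rV.
Arguments lebesgue_rV {R n}.

Section geometry.
Context {R : realType} {N : nat}.
Implicit Types (x y e : 'rV[R]_N) (Omega : set 'rV[R]_N).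

Definition dot x y : R := \sum_i x ord0 i * y ord0 i.

(* The library norm `|x| of a row vector is the max norm, which induces the
   same topology. *)
Definition enorm x : R := Num.sqrt (dot x x).

Definition is_domain Omega := [/\ Omega !=set0, open Omega & connected Omega].

(* Near each boundary point, Omega is the strict epigraph, in the direction of
   some unit vector e, of a Lipschitz function on the hyperplane orthogonal to
   e. *)
Definition lipschitz_boundary Omega :=
  forall x0, (closure Omega `\` interior Omega) x0 ->
  exists (r L : R) (e : 'rV[R]_N) (g : 'rV[R]_N -> R),
    [/\ 0 < r, enorm e = 1,
        forall y z, dot y e = 0 -> dot z e = 0 ->
          `|g y - g z| <= L * enorm (y - z)
      & forall x, enorm (x - x0) < r ->
          (Omega x <-> g (x - dot x e *: e) < dot x e)].

Definition is_cone Omega :=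
  [/\ is_domain Omega, lipschitz_boundary Omega
    & forall (t : R) x, 0 < t -> Omega x -> Omega (t *: x)].

End geometry.

Section D012.
Context {R : realType} {N : nat}.
Implicit Types (Omega : set 'rV[R]_N) (phi : 'rV[R]_N -> R).

Definition partial (i : 'I_N) phi : 'rV[R]_N -> R :=
  'D_(delta_mx ord0 i : 'rV[R]_N) phi.

Fixpoint is_Ck (k : nat) phi : Prop :=
  match k with
  | 0 => continuous phi
  | j.+1 => continuous phi /\
      forall i : 'I_N,
        (forall x, derivable phi x (delta_mx ord0 i : 'rV[R]_N)) /\
        is_Ck j (partial i phi)
  end.

(* C_c^oo(Omega); its elements are functions on R^N, extended by zero. *)
Definition test_function Omega phi :=
  [/\ forall k, is_Ck k phi,
      compact (closure [set x | phi x != 0])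
    & closure [set x | phi x != 0] `<=` Omega].

Definition grad_norm Omega phi : \bar R :=
  ((\int[lebesgue_rV]_(x in Omega) (\sum_i partial i phi x ^+ 2)%:E)
     `^ 2^-1)%E.

(* The Hardy-Sobolev exponent 2^*(s); 2^*(0) is the Sobolev exponent 2^*. *)
Definition crit (n : nat) (s : R) : R := 2 * (n%:R - s) / (n%:R - 2).

Local Notation ae_class := {mfun_ (@lebesgue_rV R N), 'rV[R]_N >-> R}.

Definition ae_class0 : ae_class := (\pi_ae_class (cst 0 : {mfun _ >-> R}))%qT.

(* The completion of C_c^oo(Omega) in [grad_norm Omega], realised as a space
   of functions modulo equality almost everywhere (for N >= 3): by the Sobolev
   inequality, a Cauchy sequence of test functions for the gradient norm
   converges in L^{2^*}, and the element of the completion that it represents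
   is identified with its limit. The functions are extended by zero out of
   Omega. *)
Definition D012 Omega : set ae_class :=
  [set u : ae_class | exists phi : nat -> 'rV[R]_N -> R,
    [/\ forall n, test_function Omega (phi n),
        forall eps : R, 0 < eps -> exists n0 : nat, forall n m : nat,
          (n0 <= n)%N -> (n0 <= m)%N ->
          (grad_norm Omega (phi n \- phi m)%R < eps%:E)%E
      & (fun n => 'N[lebesgue_rV]_((crit N 0)%:E)
            [EFin \o (fun x => u x - phi n x)%R])%E @ \oo --> 0%E]].

Definition Dprod Omega : set (ae_class * ae_class) := D012 Omega `*` D012 Omega.

(* On Dprod the integral is finite, by the Hardy-Sobolev inequality. At the
   origin, the only zero of [enorm], the integrand takes the junk value 0; this
   is a null set. *)
Definition Dtilde Omega (s alpha beta lambda mu kappa : R)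
    : set (ae_class * ae_class) :=
  [set w | Dprod Omega w /\
    (0 < \int[lebesgue_rV]_(x in Omega)
      (lambda * (`|w.1 x| `^ crit N s / enorm x `^ s)
       + mu * (`|w.2 x| `^ crit N s / enorm x `^ s)
       + crit N s * kappa
           * (`|w.1 x| `^ alpha * `|w.2 x| `^ beta / enorm x `^ s))%:E)%E].

End D012.

(* Main.v *)
Require Import Defs.
From mathcomp Require Import all_boot all_order all_algebra.
From mathcomp Require Import all_classical all_reals all_analysis.
From mathcomp Require Import measurable_realfun ring lra.
Import Order.TTheory GRing.Theory Num.Theory.
Import numFieldNormedType.Exports.
Local Open Scope classical_set_scope.
Local Open Scope ring_scope.

(** The proposition is a pointwise statement in disguise. By the weighted
Young inequality, the integrand multiplied by |x|^s is, with p = 2^*(s),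

  lambda |u|^p + mu |v|^p + p kappa |u|^alpha |v|^beta
    >= p (kappa + (lambda/alpha)^(alpha/p) (mu/beta)^(beta/p))
         |u|^alpha |v|^beta,

and the hypothesis on kappa says exactly that the last coefficient is positive.
Hence the left-hand side is positive where u and v are both nonzero. Where one
of them is zero the coupling term drops out, and the pure powers that remain
vanish only if u = v = 0 ([density_gt0]). As the integral of a nonnegative
function is positive unless the function vanishes almost everywhere
([integral_gt0P]), and the weight |x|^(-s) vanishes at most at the origin, a
null set ([lebesgue_rV_set1]), the integral over Omega is positive unless
u = v = 0 almost everywhere in Omega.

It remains to pass from Omega to the whole space, because elements of
D_0^{1,2}(Omega) are classes of functions on R^N. They are limits in L^{2^*} of
functions supported in Omega, so they vanish almost everywhere outside Omega
([D012_vanishes_outside]), and being zero a.e. in Omega is being the zero class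
([ae_class0P]). *)

(** * The coupled density *)

(** This is Young's inequality for the conjugate exponents p/alpha and p/beta,
p = alpha + beta, at the powers alpha/p and beta/p of (lambda/alpha) a^p and
(mu/beta) b^p: the coefficients are tuned so that the right-hand side of
Young's inequality has exactly the weights lambda/p and mu/p. *)
Lemma weighted_young (R : realType) (alpha beta lambda mu a b : R) :
  0 < alpha -> 0 < beta -> 0 < lambda -> 0 < mu -> 0 <= a -> 0 <= b ->
  (alpha + beta) * ((lambda / alpha) `^ (alpha / (alpha + beta))
      * (mu / beta) `^ (beta / (alpha + beta))) * (a `^ alpha * b `^ beta)
  <= lambda * a `^ (alpha + beta) + mu * b `^ (alpha + beta).
Proof.
move=> al0 be0 la0 mu0 a0 b0.
set p := alpha + beta; have p0 : 0 < p by rewrite addr_gt0.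
have la1 : 0 <= lambda / alpha by rewrite divr_ge0// ltW.
have mu1 : 0 <= mu / beta by rewrite divr_ge0// ltW.
have powK t g : 0 <= t -> 0 < g -> (t `^ (g / p)) `^ (p / g) = t.
  move=> t0 g0; rewrite -powRrM (_ : g / p * (p / g) = 1) ?powRr1//.
  by field; rewrite !gt_eqF.
have powE c t g : 0 <= c -> 0 <= t ->
    c `^ (g / p) * t `^ g = (c * t `^ p) `^ (g / p).
  move=> c0 t0; rewrite powRM ?powR_ge0// -powRrM.
  by rewrite (_ : p * (g / p) = g)//; field; rewrite gt_eqF.
rewrite -mulrA mulrACA !powE//.
set X := lambda / alpha * a `^ p; set Y := mu / beta * b `^ p.
have X0 : 0 <= X by rewrite /X mulr_ge0 ?powR_ge0.
have Y0 : 0 <= Y by rewrite /Y mulr_ge0 ?powR_ge0.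
have pq : (p / alpha)^-1 + (p / beta)^-1 = 1.
  by rewrite /p in p0 *; field; rewrite !gt_eqF.
have := @conjugate_powR R (X `^ (alpha / p)) (Y `^ (beta / p)) (p / alpha)
  (p / beta) (powR_ge0 _ _) (powR_ge0 _ _) (divr_gt0 p0 al0) (divr_gt0 p0 be0)
  pq.
rewrite !powK// -(ler_pM2l p0) => /le_trans; apply.
rewrite /X /Y le_eqVlt; apply/orP; left; apply/eqP; field.
by rewrite !gt_eqF.
Qed.

(** If a and b are both positive, Young's inequality leaves a positive multiple
of a^alpha b^beta; otherwise the coupling term is absent, whatever the sign of
kappa, and one of the two pure powers is positive. *)
Lemma density_gt0 (R : realType) (alpha beta lambda mu kappa a b : R) :
  0 < alpha -> 0 < beta -> 0 < lambda -> 0 < mu -> 0 <= a -> 0 <= b ->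
  - ((lambda / alpha) `^ (alpha / (alpha + beta))
     * (mu / beta) `^ (beta / (alpha + beta))) < kappa ->
  (a != 0) || (b != 0) ->
  0 < lambda * a `^ (alpha + beta) + mu * b `^ (alpha + beta)
      + (alpha + beta) * kappa * (a `^ alpha * b `^ beta).
Proof.
move=> al0 be0 la0 mu0 a0 b0 ka ab0.
have p0 : 0 < alpha + beta by rewrite addr_gt0.
have [ab|ab] := eqVneq (a `^ alpha * b `^ beta) 0.
  rewrite ab mulr0 addr0.
  have [a00|an0] := eqVneq a 0.
    rewrite ltr_wpDl ?mulr_ge0 ?powR_ge0 ?ltW// mulr_gt0// powR_gt0// lt0r b0.
    by move: ab0; rewrite a00 eqxx => /= ->.
  rewrite ltr_pwDl ?mulr_ge0 ?powR_ge0 ?(ltW mu0)//.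
  by rewrite mulr_gt0// powR_gt0// lt0r an0.
have ab_gt0 : 0 < a `^ alpha * b `^ beta.
  by rewrite lt0r ab mulr_ge0 ?powR_ge0.
have := weighted_young _ _ _ _ _ a b al0 be0 la0 mu0 a0 b0.
set c := _ * (mu / beta) `^ _ in ka *; move=> young.
have : 0 < (alpha + beta) * (kappa + c) * (a `^ alpha * b `^ beta).
  by rewrite mulr_gt0// mulr_gt0//; lra.
lra.
Qed.

(** * Borel sets and null sets of R^n *)

Section lebesgue_space.
Context {R : realType}.

(** The sigma-algebra is generated by the coordinates, so an open set has to be
exhausted by countably many boxes: those with rational centre and radius
1/(k+1) that it contains. *)
Lemma open_measurable_rV n (A : set 'rV[R]_n) : open A -> measurable A.
Proof.
move=> oA.
pose c (q : 'rV[rat]_n) : 'rV[R]_n := \row_i ratr (q ord0 i).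
pose F (qk : 'rV[rat]_n * nat) : set 'rV[R]_n :=
  if `[< ball (c qk.1) qk.2.+1%:R^-1 `<=` A >]
  then ball (c qk.1) qk.2.+1%:R^-1 else set0.
have mF qk : measurable (F qk).
  rewrite /F; case: asboolP => // _.
  rewrite (_ : ball _ _ = \bigcap_(i in [set: 'I_n])
      ((fun x : 'rV[R]_n => x ord0 i) @^-1`
        (ball (c qk.1 ord0 i) qk.2.+1%:R^-1))).
    apply: fin_bigcap_measurable => [|i _] //.
    rewrite -[X in measurable X]setTI.
    apply: measurable_coord => //; exact: measurable_ball.
  apply/seteqP; split=> x /=.
    by move=> [_ cx] i _; exact: cx.
  by move=> cx; split=> [|i j]; rewrite ?invr_gt0// ord1; exact: cx.
suff -> : A = \bigcup_qk F qk by exact: countable_bigcupT_measurable.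
apply/seteqP; split=> [x Ax|x [qk _]]; last first.
  by rewrite /F; case: asboolP => // qA; exact: qA.
have /nbhs_ballP[e /= e0 eA] := open_nbhs_nbhs (conj oA Ax).
(* A radius below e / 2 keeps inside the e-ball about x any box that
   contains x. *)
have [k ke] : exists k : nat, k.+1%:R^-1 < e / 2.
  have e20 : 0 < e / 2 by rewrite divr_gt0.
  have [k _ /(_ k (leqnn k))] := near_infty_natSinv_lt (PosNum e20).
  by exists k.
have k0 : 0 < k.+1%:R^-1 :> R by rewrite invr_gt0.
have /choice[q qx] (i : 'I_n) :
    exists q : rat, ball (ratr q : R) k.+1%:R^-1 (x ord0 i).
  have [q] := @rat_in_itvoo R (x ord0 i) (x ord0 i + k.+1%:R^-1)
    ltac:(by rewrite ltrDl).
  rewrite in_itv/= => /andP[xq qx]; exists q.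
  by rewrite /ball/= ger0_norm ?ltrBlDl ?subr_ge0 ?(ltW xq).
have cqx : ball (c (\row_i q i)) k.+1%:R^-1 x.
  by split=> // i j; rewrite ord1 !mxE; exact: qx.
exists (\row_i q i, k) => //; rewrite /F; case: asboolP => // -[] y /= cqy.
apply: eA; rewrite (splitr e).
apply: ball_triangle (le_ball (ltW ke) (ball_sym cqx)) _.
exact: le_ball (ltW ke) _ cqy.
Qed.

Lemma continuous_measurable_rV n (f : 'rV[R]_n -> R) :
  continuous f -> measurable_fun [set: 'rV[R]_n] f.
Proof.
move=> /continuousP cf; apply: (measurability _ (RGenOpens.measurableE R)).
move=> _ [_ [a [b ->] <-]]; rewrite setTI; apply: open_measurable_rV.
exact/cf/interval_open.
Qed.

Lemma enorm_eq0 n (x : 'rV[R]_n) : (enorm x == 0) = (x == 0).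
Proof.
have sq_ge0 i : 0 <= x ord0 i * x ord0 i by rewrite -expr2 sqr_ge0.
rewrite sqrtr_eq0; apply/idP/eqP => [x0|->]; last first.
  by rewrite /dot big1// => i _; rewrite mxE mul0r.
apply/rowP => i; rewrite mxE; apply/eqP.
have : dot x x == 0 by rewrite eq_le x0 sumr_ge0.
rewrite psumr_eq0// => /allP/(_ i (mem_index_enum i))/=.
by rewrite mulf_eq0 orbb.
Qed.

Lemma measurable_enorm n : measurable_fun [set: 'rV[R]_n] enorm.
Proof.
have -> : @enorm R n = (@powR R ^~ 2^-1) \o (fun x => dot x x).
  apply/funext => x /=; rewrite powR12_sqrt// sumr_ge0// => i _.
  by rewrite -expr2 sqr_ge0.
apply: measurableT_comp; first exact: measurable_powR.
by apply: measurable_sum => i; apply: measurable_funM; exact: measurable_coord.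
Qed.

Lemma measurable_rV_set1 n (a : 'rV[R]_n) : measurable [set a].
Proof.
rewrite (_ : [set a] = \bigcap_(i in [set: 'I_n])
  ((fun x : 'rV[R]_n => x ord0 i) @^-1` [set a ord0 i])).
  apply: fin_bigcap_measurable => [|i _] //; rewrite -[X in measurable X]setTI.
  by apply: measurable_coord.
apply/seteqP; split=> x /= => [-> //|xa].
by apply/rowP => i; exact: xa.
Qed.

(** R^(n+1) is measured as R * R^n, and already the first coordinate of a point
ranges over a null set of R. *)
Lemma lebesgue_rV_set1 n (a : 'rV[R]_n.+1) : lebesgue_rV [set a] = 0%E.
Proof.
pose a' : 'rV[R]_n := \row_j a ord0 (lift ord0 j).
rewrite /= /lebesgue_rV_step /pushforward.
rewrite (_ : _ @^-1` _ = [set a ord0 ord0] `*` [set a']).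
  rewrite product_measure1E;
    [|exact: measurable_set1|exact: measurable_rV_set1].
  rewrite -[RHS](mul0e (lebesgue_rV [set a'])); congr (_ * _)%E.
  exact: lebesgue_measure_set1.
apply/seteqP; split=> [[t x]/= /rowP tx|[t x]/= [-> ->]].
  split; first by have := tx ord0; rewrite !mxE unlift_none.
  by apply/rowP => i; have := tx (lift ord0 i); rewrite !mxE liftK.
by apply/rowP => i; rewrite !mxE; case: unliftP => [j|] ->; rewrite ?mxE.
Qed.

End lebesgue_space.

(** * Integrals of nonnegative functions *)

Lemma integral_gt0P d (T : measurableType d) (R : realType)
    (mu : {measure set T -> \bar R}) (D : set T) (f : T -> \bar R) :
  measurable D -> measurable_fun D f -> (forall x, D x -> (0 <= f x)%E) ->
  (0 < \int[mu]_(x in D) f x)%E <-> ~ ae_eq mu D f (cst 0%E).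
Proof.
move=> mD mf f0; rewrite -ae_eq_integral_abs//.
rewrite (@eq_integral _ _ _ mu D f); last first.
  by move=> x; rewrite inE => Dx; rewrite gee0_abs// f0.
rewrite lt0e integral_ge0// andbT; split => [/eqP//|?]; exact/eqP.
Qed.

Lemma Lnorm_le d (T : measurableType d) (R : realType)
    (mu : {measure set T -> \bar R}) (p : R) (f g : T -> R) :
  0 < p -> measurable_fun setT f -> measurable_fun setT g ->
  (forall x, `|f x| <= `|g x|) ->
  ('N[mu]_p%:E[EFin \o f] <= 'N[mu]_p%:E[EFin \o g])%E.
Proof.
move=> p0 mf mg fg; have p0' := ltW p0.
have int_ge0 (h : T -> R) : (0 <= \int[mu]_x (`|(EFin \o h) x| `^ p))%E.
  by apply: integral_ge0 => x _; exact: poweR_ge0.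
have mpow (h : T -> R) : measurable_fun setT h ->
    measurable_fun setT (fun x => `|(EFin \o h) x| `^ p)%E.
  move=> mh; apply: (measurableT_comp (measurable_poweR _)).
  by apply: measurableT_comp => //; exact/measurable_EFinP.
rewrite unlock; apply: gt0_ler_poweR;
  rewrite ?invr_ge0 ?in_itv/= ?leey ?int_ge0//.
apply: ge0_le_integral => // [| |x _]; [exact: mpow|exact: mpow|].
by rewrite lee_fin ge0_ler_powR ?nnegrE.
Qed.

(** * Functions of D_0^{1,2} vanish outside the domain *)

Section classes.
Context {R : realType} {N : nat}.
Local Notation ae_class := {mfun_ (@lebesgue_rV R N), 'rV[R]_N >-> R}.

Lemma measurable_ae_class (u : ae_class) : measurable_fun setT u.
Proof. exact: (@measurable_funPT _ _ _ _ (repr u)). Qed.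

Lemma ae_class0P (u : ae_class) :
  u = ae_class0 <-> ae_eq lebesgue_rV setT u (cst 0).
Proof.
rewrite /ae_class0 -{1}[u]reprK; split.
  by move/eqmodP/asboolP.
by move=> u0; apply/eqmodP/asboolP.
Qed.

(** Outside Omega the approximating test functions are zero, so there u is its
own approximation error: the L^{2^*} norm of u restricted to the complement is
below that of u - phi_n for every n, hence zero. *)
Lemma D012_vanishes_outside (Omega : set 'rV[R]_N) (u : ae_class) :
  0 < crit N 0 :> R -> open Omega -> D012 Omega u ->
  ae_eq lebesgue_rV (~` Omega) u (cst 0).
Proof.
move=> p0 oO [phi [phiO _ phiu]].
have mu := measurable_ae_class u.
have mO : measurable (~` Omega).
  by apply: measurableC; exact: open_measurable_rV.
pose g := (u : 'rV[R]_N -> R) \* \1_(~` Omega).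
have mg : measurable_fun setT g by apply: measurable_funM.
have g_le n : ('N[lebesgue_rV]_(crit N 0)%:E[EFin \o g] <=
    'N[lebesgue_rV]_(crit N 0)%:E[EFin \o (fun x => u x - phi n x)%R])%E.
  have [smooth _ suppO] := phiO n.
  apply: Lnorm_le => // [|x].
    apply: measurable_funB => //; apply: continuous_measurable_rV.
    exact: smooth 0%N.
  rewrite /g/= indicE; have [Ox|nOx] := boolP (x \in ~` Omega); last first.
    by rewrite mulr0 normr0.
  suff -> : phi n x = 0 by rewrite mulr1 subr0.
  apply/eqP/negP => /negP px; move: Ox; rewrite inE; apply.
  exact/suppO/subset_closure.
have g0 : ('N[lebesgue_rV]_(crit N 0)%:E[EFin \o g] = 0)%E.
  apply/eqP; rewrite eq_le Lnorm_ge0 andbT.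
  by apply: cvge_ge phiu; exact: nearW.
have := @Lnorm_eq0_eq0 _ _ _ lebesgue_rV (EFin \o g) (crit N 0)%:E.
move=> /(_ _ _ g0) h.
have {}h := h ltac:(exact/measurable_EFinP) ltac:(by rewrite lte_fin).
apply: filterS h => x /(_ I) /= [gx] Ox.
by move: gx; rewrite /g/= indicE mem_set// mulr1.
Qed.

End classes.

(** * Positivity of the functional *)

Theorem proposition6 (R : realType) (N : nat) (hN : (3 <= N)%N)
  (Omega : set 'rV[R]_N)
  (hOmega : is_cone Omega \/ (is_domain Omega /\ ~ closure Omega 0))
  (s alpha beta lambda mu kappa : R)
  (hs : 0 < s < 2) (halpha : 1 < alpha) (hbeta : 1 < beta)
  (hab : alpha + beta = crit N s)
  (hlambda : 0 < lambda) (hmu : 0 < mu)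
  (hkappa : - ((lambda / alpha) `^ (alpha / crit N s)
               * (mu / beta) `^ (beta / crit N s)) < kappa) :
  Dtilde Omega s alpha beta lambda mu kappa
    = Dprod Omega `\` [set (ae_class0, ae_class0)].
Proof.
have oO : open Omega by case: hOmega => [[[]]|[[]]].
have mO := open_measurable_rV _ _ oO.
have N2 : 2 < N%:R :> R by rewrite ltr_nat.
have crit0 : 0 < crit N 0 :> R.
  by rewrite /crit subr0 divr_gt0 ?mulr_gt0 ?subr_gt0//; lra.
have a0 : 0 < alpha by lra.
have b0 : 0 < beta by lra.
have p0 : 0 < crit N s by rewrite -hab addr_gt0.
rewrite -hab in hkappa p0.
pose e (x y : R) := lambda * `|x| `^ (alpha + beta)
  + mu * `|y| `^ (alpha + beta)
  + (alpha + beta) * kappa * (`|x| `^ alpha * `|y| `^ beta).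
have e00 : e 0 0 = 0.
  by rewrite /e normr0 !powR0 ?gt_eqF// !mulr0 !addr0.
have e_gt0 x y : (x != 0) || (y != 0) -> 0 < e x y.
  by move=> xy; apply: density_gt0; rewrite ?normr_eq0.
have e_ge0 x y : 0 <= e x y.
  have [/e_gt0/ltW //|] := boolP ((x != 0) || (y != 0)).
  by rewrite negb_or !negbK => /andP[/eqP-> /eqP->]; rewrite e00.
apply/seteqP; rewrite /Dtilde -hab.
(* The weight is written as the power -s of the norm, which takes the value 0
   at the origin just like division by 0. *)
suff key (u v : {mfun_ (@lebesgue_rV R N), 'rV[R]_N >-> R}) :
    D012 Omega u -> D012 Omega v ->
    (0 < \int[lebesgue_rV]_(x in Omega) (e (u x) (v x) * enorm x `^ (- s))%:E)%E
      <-> (u, v) <> (ae_class0, ae_class0).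
  have density (u v : 'rV[R]_N -> R) :
      (fun x => (e (u x) (v x) * enorm x `^ (- s))%:E) =
      (fun x => (lambda * (`|u x| `^ (alpha + beta) / enorm x `^ s)
       + mu * (`|v x| `^ (alpha + beta) / enorm x `^ s)
       + (alpha + beta) * kappa
           * (`|u x| `^ alpha * `|v x| `^ beta / enorm x `^ s))%:E).
    by apply/funext => x; congr EFin; rewrite powRN /e; ring.
  split=> -[u v] /= [[Du Dv]]; rewrite -density => /key h.
  + by split=> //; exact: h.
  + by split=> //; exact: h.
move=> Du Dv; rewrite integral_gt0P//; last 2 first.
- apply/measurable_EFinP/measurable_funTS/measurable_funM; last first.
    exact: (measurableT_comp (measurable_powR _) (measurable_enorm _)).
  have mabs (f : {mfun_ (@lebesgue_rV R N), 'rV[R]_N >-> R}) (q : R) :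
      measurable_fun setT (fun x => `|f x| `^ q).
    apply: (measurableT_comp (measurable_powR _)).
    apply: (measurableT_comp (@normr_measurable R setT)).
    exact: measurable_ae_class.
  by do ?[exact: mabs | apply: measurable_funD | apply: measurable_funM].
- by move=> x _; rewrite lee_fin mulr_ge0 ?powR_ge0.
suff : ae_eq lebesgue_rV Omega
    (fun x => (e (u x) (v x) * enorm x `^ (- s))%:E) (cst 0%E) <->
    (u, v) = (ae_class0, ae_class0) by move=> ->.
split=> [e0|[/ae_class0P u0 /ae_class0P v0]]; last first.
  by apply: filterS2 u0 v0 => x /(_ I) /= -> /(_ I) -> _; rewrite e00 mul0r.
have x0 : {ae lebesgue_rV, forall x : 'rV[R]_N, x <> 0}.
  exists [set 0]; split => [||x /= /contrapT//].
    exact: measurable_rV_set1.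
  by case: (N) hN => // n _; exact: lebesgue_rV_set1.
have uO := D012_vanishes_outside _ _ crit0 oO Du.
have vO := D012_vanishes_outside _ _ crit0 oO Dv.
suff uv0 : {ae lebesgue_rV, forall x, u x = 0 /\ v x = 0}.
  by congr pair; apply/ae_class0P; apply: filterS uv0 => x [].
(* At almost every x: if x is in Omega and x <> 0 then the weight is nonzero, so
   the density vanishes and u x = v x = 0; out of Omega this is the support
   property. *)
apply: filterS2 (filterI e0 x0) (filterI uO vO) => x [/= ex xn0] [ux vx].
have [Ox|nOx] := pselect (Omega x); last by rewrite ux// vx.
have enorm0 : enorm x != 0 by rewrite enorm_eq0; exact/eqP.
case: (ex Ox) => /eqP; rewrite mulf_eq0 powR_eq0 (negPf enorm0)/= orbF => exy.
have : ~~ ((u x != 0) || (v x != 0)).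
  by apply/negP => /e_gt0; rewrite lt0r exy.
by rewrite negb_or !negbK => /andP[/eqP-> /eqP->].
Qed.
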